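(* Let $\{\bm z\}=(\bm z_1,\dots,\bm z_J)$ be the collection of all decision variables of the network, with $\bm z_j\sim \mathrm{Cat}(\bm\pi_j)$ mutually independent, let $\mathcal E(\{\bm z\})$ be the network storage size of the configuration $\{\bm z\}$, and let $e^*\in\mathbb R$ be the target size. If $$\mathcal L_{\mathcal E}^{z} := E_{\{\bm z\}}\big[\,|\mathcal E(\{\bm z\})-e^*|\,\big]=0,$$ then for any sample $\{\bm z^s\}$ of $\{\bm z\}$ having non-zero probability, $\mathcal E(\{\bm z^s\})=e^*$; moreover, the most likely configuration $\{\gamma(\bm\pi)\}=(\gamma(\bm\pi_1),\dots,\gamma(\bm\pi_J))$ satisfies $\mathcal E(\{\gamma(\bm\pi)\})=e^*$.
   Context: Categorical variables: for a probability vector $\bm\pi\in\mathbb R^K$ (nonnegative entries $\pi[k]$ summing to 1), $\bm z\sim\mathrm{Cat}(\bm\pi)$ means that $\bm z\in\{0,1\}^K$ is a random one-hot vector with $P(z[k]=1)=\pi[k]$. Each decision variable $\bm z_j$ ranges over the one-hot vectors of length $K_j$ (its options), where $K_j$ is the length of $\bm\pi_j$. A configuration is an assignment of a one-hot vector to every decision variable. Storage size: the network has finitely many layers. Each layer has three decision variables: sparsity $\bm z_s$ over options $s_1,\dots,s_{K_s}\in(0,1]$ (fraction of non-zero weights), bitwidth $\bm z_q$ over options $b_1,\dots,b_{K_q}$ (positive integers), and width $\bm z_w$ over options $\rho_1,\dots,\rho_{K_w}\in(0,1]$ (fraction of non-zero channels, $\rho=\|\bm w\|_0/|\bm w|$,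 where $\bm w$ is the binary width mask of the layer, $|\bm w|$ its number of elements and $\|\bm w\|_0$ its number of non-zeros). The storage size of a layer with sparsity $s$, bitwidth $b$, width fraction $\rho$ is $$\epsilon(s,b,\rho)=\big(b-s\log_2 s-(1-s)\log_2(1-s)\big)\,\|\bm w\|_0,\qquad \|\bm w\|_0=\rho|\bm w|,$$ with $0\log_2 0=0$. The storage size of the layer under its decision variables is $\epsilon\big(\sum_k z_s[k]s_k,\ \sum_k z_q[k]b_k,\ \sum_k z_w[k]\rho_k\big)$, and $\mathcal E(\{\bm z\})$ is the sum of these over all layers of the network; it is a real-valued function of the configuration. Most likely option: $\gamma(\bm\pi)=\mathrm{onehot}(\arg\max_k \pi[k])$, the one-hot vector with its 1 at an index maximizing $\pi[k]$ (ties broken in any fixed way). *)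

(* Defs.v *)
From HB Require Import structures.
From mathcomp Require Export all_boot all_order all_algebra.
From mathcomp Require Export all_classical all_reals all_analysis.

Set Implicit Arguments.
Unset Strict Implicit.
Unset Printing Implicit Defensive.

Import Order.TTheory GRing.Theory Num.Theory.

Local Open Scope classical_set_scope.
Local Open Scope ring_scope.

(** * One-hot vectors and categorical variables *)

Definition hot K (k : 'I_K) : {ffun 'I_K -> bool} := [ffun i => i == k].

Definition is_onehot K (z : {ffun 'I_K -> bool}) : bool :=
  [exists k, z == hot k].

Record onehot K :=
  OneHot { onehot_val :> {ffun 'I_K -> bool}; onehotP : is_onehot onehot_val }.

HB.instance Definition _ K := [isSub for @onehot_val K].
HB.instance Definition _ K := [Finite of onehot K by <:].

Lemma is_onehot_hot K (k : 'I_K) : is_onehot (hot k).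
Proof. by apply/existsP; exists k. Qed.

Definition onehot_at K (k : 'I_K) : onehot K := OneHot (is_onehot_hot k).

Record pvec (R : realType) K := PVec {
  pvec_val :> 'I_K -> R;
  pvec_ge0 : forall k, 0 <= pvec_val k;
  pvec_sum1 : \sum_(k < K) pvec_val k = 1 }.

Section RandomVariables.
Context d (Omega : measurableType d) (R : realType) (P : probability Omega R).

(* Measurability for the power-set sigma-algebra on [T].  The library's
   [measurableType] only has pointed carriers, and [onehot 0] is empty. *)
Definition discrete_rv (T : Type) (X : Omega -> T) : Prop :=
  forall B : set T, measurable (X @^-1` B).

Definition categorical K (z : Omega -> onehot K) (p : pvec R K) : Prop :=
  discrete_rv z /\ forall k, P [set w | z w k] = (p k)%:E.

Definition mutually_independent (J : finType) (T : J -> Type)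
    (X : forall j, Omega -> T j) : Prop :=
  forall (S : {set J}) (B : forall j, set (T j)),
    P (\bigcap_(j in [set` S]) (X j @^-1` B j)) =
    (\prod_(j in S) P (X j @^-1` B j))%E.

End RandomVariables.

(** * Most likely option *)

(* A fixed way of choosing a maximizing index, i.e. of breaking ties. *)
Definition is_argmax (R : realType) (amax : forall K, pvec R K -> 'I_K) : Prop :=
  forall K (p : pvec R K) (k : 'I_K), p k <= p (amax K p).

Definition most_likely (R : realType) (amax : forall K, pvec R K -> 'I_K)
    K (p : pvec R K) : onehot K := onehot_at (amax K p).

(* [pvec R 0] is empty, so such a choice does exist for all lengths at once. *)
Lemma is_argmax_exists (R : realType) :
  exists amax : forall K, pvec R K -> 'I_K, is_argmax amax.
Proof.
have H K (p : pvec R K) : {k : 'I_K | forall i, p i <= p k}.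
  case: K p => [|K] p.
    by exfalso; have /eqP := pvec_sum1 p; rewrite big_ord0 eq_sym oner_eq0.
  exists [arg max_(i > ord0) p i]%O => i.
  by case: arg_maxP => // k _; exact.
by exists (fun K p => sval (H K p)) => K p k; exact: (svalP (H K p)).
Qed.

(** * Networks and storage size *)

Variant kind := Sparsity | Bitwidth | Width.

Definition kind_code (v : kind) : option bool :=
  match v with
  | Sparsity => None | Bitwidth => Some false | Width => Some true
  end.
Definition kind_decode (o : option bool) : kind :=
  match o with
  | None => Sparsity | Some false => Bitwidth | Some true => Width
  end.
Lemma kind_codeK : cancel kind_code kind_decode. Proof. by case. Qed.
HB.instance Definition _ := Finite.copy kind (can_type kind_codeK).

Record layer (R : realType) := Layer {
  layer_nopt : kind -> nat;
  sparsity_opt : 'I_(layer_nopt Sparsity) -> R;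
  bitwidth_opt : 'I_(layer_nopt Bitwidth) -> nat;
  width_opt : 'I_(layer_nopt Width) -> R;
  mask_size : nat; (* |w|, the length of the width mask *)
  sparsity_opt_itv : forall k, 0 < sparsity_opt k <= 1;
  bitwidth_opt_gt0 : forall k, (0 < bitwidth_opt k)%N;
  width_opt_itv : forall k, 0 < width_opt k <= 1;
  mask_size_gt0 : (0 < mask_size)%N }.

Definition network (R : realType) L := 'I_L -> layer R.

(* Decision variables of a network with L layers. *)
Definition dvar L : finType := ('I_L * kind)%type.

Definition nopt (R : realType) L (net : network R L) (j : dvar L) : nat :=
  layer_nopt (net j.1) j.2.

Definition config (R : realType) L (net : network R L) :=
  forall j : dvar L, onehot (nopt net j).

Definition log2 (R : realType) (x : R) : R := ln x / ln 2.

(* epsilon(s, b, rho), where n = |w| and hence ||w||_0 = rho * n.  The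
   convention 0 log2 0 = 0 at s = 1 holds since [ln] is total. *)
Definition layer_size (R : realType) (n : nat) (s b rho : R) : R :=
  (b - s * log2 s - (1 - s) * log2 (1 - s)) * (rho * n%:R).

Definition selected (R : realType) K (z : onehot K) (x : 'I_K -> R) : R :=
  \sum_(k < K) (z k)%:R * x k.

Definition storage_size (R : realType) L (net : network R L)
    (z : config net) : R :=
  \sum_(l < L)
    layer_size (mask_size (net l))
      (selected (z (l, Sparsity)) (@sparsity_opt R (net l)))
      (selected (z (l, Bitwidth)) (fun k => (@bitwidth_opt R (net l) k)%:R))
      (selected (z (l, Width)) (@width_opt R (net l))).

Definition storage_loss d (Omega : measurableType d) (R : realType)
    (P : probability Omega R) L (net : network R L)
    (z : forall j : dvar L, Omega -> onehot (nopt net j)) (estar : R) : \bar R :=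
  ('E_P[(fun w => `|storage_size (fun j => z j w) - estar|)%R])%E.

(* Main.v *)
(* A nonnegative variable with zero mean vanishes almost surely, so an event of
   positive probability cannot lie in the set where the storage size differs
   from the target.  By independence the most likely configuration has
   probability the product of the maximal entries of the [p j], each of which is
   positive because the entries sum to 1. *)
Require Import Defs.
From mathcomp Require Import measurable_realfun.

Import Order.TTheory GRing.Theory Num.Theory.

Local Open Scope classical_set_scope.
Local Open Scope ring_scope.

(** There are finitely many joint outcomes, so the event is a finite union of finite intersections
    of preimages of singletons. Allowing any [Q] avoids putting a sigma-algebra on dependent
    tuples. *)
Lemma measurable_joint_event (d : measure_display) (Omega : measurableType d)
    (J : finType) (T : J -> finType) (X : forall j, Omega -> T j)
    (mX : forall j, discrete_rv (X j)) (Q : (forall j, T j) -> Prop) :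
  measurable [set w | Q (fun j => X j w)].
Proof.
have -> : [set w | Q (fun j => X j w)] =
    \bigcup_(f in [set f : {dffun forall j, T j} | Q f])
      \bigcap_(j in [set: J]) (X j @^-1` [set f j]).
  apply/seteqP; split=> [w Qw | w [f /= Qf Xf]] /=.
    (* The union is indexed by finite functions, which form a finite type, whereas [Q] takes plain
       dependent functions; extensionality passes between the two. *)
    have fE : ([ffun j => X j w] : {dffun forall j, T j}) =
        (fun j => X j w) :> (forall j, T j).
      by apply: functional_extensionality_dep => j; rewrite ffunE.
    by exists [ffun j => X j w] => /= [|j _ /=]; rewrite fE.
  suff -> : (fun j => X j w) = f by [].
  by apply: functional_extensionality_dep => j; exact: Xf.
apply: fin_bigcup_measurable => [|f _]; first exact: finite_finset.
by apply: fin_bigcap_measurable => [|j _]; [exact: finite_finset|exact: mX].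
Qed.

Lemma onehot_eq_at (K : nat) (x : onehot K) (k : 'I_K) :
  x k -> x = onehot_at k.
Proof.
case: x => v /[dup] /existsP[i /eqP ->] vi; rewrite /= ffunE => /eqP ->.
by apply: val_inj.
Qed.

Lemma argmax_gt0 (R : realType) (amax : forall K : nat, pvec R K -> 'I_K)
    (amaxP : is_argmax amax) (K : nat) (p : pvec R K) : 0 < p (amax K p).
Proof.
rewrite ltNge; apply/negP => le0.
have : \sum_(k < K) p k <= 0.
  by apply: sumr_le0 => k _; exact: le_trans (amaxP _ _ _) le0.
by rewrite pvec_sum1 ler10.
Qed.

Lemma probability_joint_event (d : measure_display) (Omega : measurableType d)
    (R : realType) (P : probability Omega R) (J : finType) (T : J -> Type)
    (X : forall j, Omega -> T j) (indep : mutually_independent P X)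
    (x : forall j, T j) :
  P [set w | forall j, X j w = x j] = (\prod_j P (X j @^-1` [set x j]))%E.
Proof.
(* Independence is used only for the full index set and singleton targets. *)
have := indep [set: J]%SET (fun j => [set x j]).
rewrite (eq_bigl xpredT) => [<-|j]; last by rewrite inE.
congr (P _); apply/seteqP; split=> w /= Xw j; first by move=> _; exact: Xw.
by apply: Xw; rewrite /= inE.
Qed.

Lemma categorical_at (d : measure_display) (Omega : measurableType d)
    (R : realType) (P : probability Omega R) (K : nat) (z : Omega -> onehot K)
    (p : pvec R K) (k : 'I_K) :
  categorical P z p -> P (z @^-1` [set onehot_at k]) = (p k)%:E.
Proof.
move=> [_ <-]; congr (P _); apply/seteqP; split=> w /=; last exact: onehot_eq_at.
by move=> ->; rewrite /= ffunE eqxx.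
Qed.

Theorem lemma4p1 (R : realType) (L : nat) (net : network R L)
    (d : measure_display) (Omega : measurableType d) (P : probability Omega R)
    (p : forall j : dvar L, pvec R (nopt net j))
    (z : forall j : dvar L, Omega -> onehot (nopt net j))
    (estar : R)
    (amax : forall K : nat, pvec R K -> 'I_K) (amaxP : is_argmax amax)
    (z_cat : forall j : dvar L, categorical P (z j) (p j))
    (z_indep : mutually_independent P z)
    (loss0 : storage_loss P z estar = 0%E) :
  (forall zs : config net,
      P [set w | forall j : dvar L, z j w = zs j] != 0%E ->
      storage_size zs = estar) /\
  storage_size (fun j : dvar L => most_likely amax (p j)) = estar.
Proof.
have mz (Q : config net -> Prop) : measurable [set w | Q (fun j => z j w)].
  apply: (@measurable_joint_event _ _ _ (fun j => onehot (nopt net j) : finType)).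
  by move=> j; case: (z_cat j).
pose err w : R := storage_size (fun j => z j w) - estar.
have merr : measurable_fun setT err.
  move=> _ B _; rewrite setTI.
  (* A preimage under [err] is an event about the configuration alone. *)
  exact: (mz (fun c => B (storage_size c - estar))).
have err0 : ae_eq P setT (EFin \o err) (cst 0%E).
  apply/ae_eq_integral_abs => //; first exact/measurable_EFinP.
  by move: loss0; rewrite /storage_loss unlock.
have pos_eq (zs : config net) :
    P [set w | forall j, z j w = zs j] != 0%E -> storage_size zs = estar.
  (* By contraposition: if [zs] misses the target, the event that [z] equals [zs] lies in the
     negligible set where [err] is non-zero. *)
  apply: contra_neq_eq => neq.
  apply/negligibleP; first exact: (mz (fun c => forall j, c j = zs j)).
  apply: negligibleS err0 => w /= zw /(_ I) [] /eqP.
  rewrite subr_eq0 (_ : (fun j => z j w) = zs) ?(negbTE neq) //.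
  exact: functional_extensionality_dep.
(* The second claim is the first one at the most likely configuration, once its probability is shown
   to be non-zero. *)
split=> //; apply: pos_eq; rewrite probability_joint_event //.
rewrite (eq_bigr (fun j => (p j (amax _ (p j)))%:E)) => [|j _].
  by rewrite prodEFin gt_eqF // lte_fin prodr_gt0 // => j _; exact: argmax_gt0.
exact: categorical_at.
Qed.
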